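(* Let $G=(V(G),E(G))$ be a finite simple graph, let $K$ be a field, let $T=K[s_i,t_i : i\in V(G)]$, and let $I\subset T$ be the monomial ideal of independent sets of $G$, whose minimal monomial generating set is $\{m_S=\prod_{i\in S}s_i\prod_{i\notin S}t_i : S \text{ an independent set of } G\}$. Then the minimal primary decomposition of $I$ is $$I=\bigcap_{i\in V(G)}(s_i,t_i)\ \cap\bigcap_{\{i,j\}\in E(G)}(t_i,t_j).$$
   Context: The vertex set is $V(G)=\{1,\dots,n\}$ with $n\ge 1$. A set $S\subseteq V(G)$ is independent if no two elements of $S$ are adjacent in $G$ (the empty set is independent). The monomial ideal of independent sets of $G$ is the squarefree monomial ideal $I\subset T=K[s_i,t_i:i\in V(G)]$ generated by the monomials $m_S=\prod_{i\in S}s_i\prod_{i\in V(G)\setminus S}t_i$, where $S$ ranges over all independent sets of $G$. ''Minimal primary decomposition'' means an irredundant one: the ideals listed are primary (here prime) ideals with pairwise distinct radicals, and none of them can be omitted from the intersection. *)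

(* Defs.v *)
From mathcomp Require Import all_boot all_algebra.
From mathcomp Require Import boolp classical_sets.
From mathcomp Require Import mpoly.

Set Implicit Arguments.
Unset Strict Implicit.
Unset Printing Implicit Defensive.

Import GRing.Theory.
Local Open Scope classical_set_scope.
Local Open Scope ring_scope.

Section Ideals.
Variable R : comNzRingType.
Implicit Types I Q B : set R.

(* Unlike [idealr_closed], this allows the unit ideal. *)
Definition is_ideal I : Prop :=
  [/\ I 0, forall x y, I x -> I y -> I (x + y) & forall a x, I x -> I (a * x)].

Definition ideal_gen B : set R := smallest is_ideal B.

Definition radical I : set R := [set x | exists k : nat, I (x ^+ k)].

Definition primary_ideal Q : Prop :=
  [/\ is_ideal Q, ~ Q 1 & forall x y, Q (x * y) -> Q x \/ radical Q y].

Definition minimal_primary_decomposition I (J : finType) (Q : J -> set R) :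
    Prop :=
  [/\ forall j, primary_ideal (Q j),
      I = \bigcap_(j in [set: J]) Q j,
      injective (fun j => radical (Q j)) &
      forall j, \bigcap_(k in [set k | k <> j]) Q k <> I].

End Ideals.

(* The members of [B] are monic monomials, they generate [I], and none of them
   can be omitted. *)
Definition minimal_monomial_generating_set (m : nat) (K : fieldType)
    (I B : set {mpoly K[m]}) : Prop :=
  [/\ forall p, B p -> exists d : 'X_{1..m}, p = 'X_[d],
      I = ideal_gen B &
      forall p, B p -> ideal_gen (B `\ p) <> I].

(* A finite simple graph on the vertex set 'I_n (that is, {1, ..., n} shifted
   by one); an edge is an unordered pair of distinct vertices. *)
Record sgraph (n : nat) := SGraph {
  edges : {set {set 'I_n}};
  edges_card2 : forall A, A \in edges -> #|A| = 2
}.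

Section IndependentSets.
Variables (n : nat) (G : sgraph n) (K : fieldType).

Definition adjacent (i j : 'I_n) : bool := ([set i; j] \in edges G)%SET.

(* Taking i = j is harmless, since [set i; i] has one element. *)
Definition independent (S : {set 'I_n}) : bool :=
  [forall i in S, forall j in S, ~~ adjacent i j].

(* K[s_i, t_i : i in V(G)] is {mpoly K[n + n]}: the first n variables are the
   s_i and the last n are the t_i. *)
Definition svar (i : 'I_n) : {mpoly K[n + n]} := 'X_(lshift n i).
Definition tvar (i : 'I_n) : {mpoly K[n + n]} := 'X_(rshift n i).

Definition set_monomial (S : {set 'I_n}) : {mpoly K[n + n]} :=
  (\prod_(i in S) svar i) * \prod_(i in ~: S) tvar i.

Definition independent_monomials : set {mpoly K[n + n]} :=
  [set p | exists2 S : {set 'I_n}, independent S & p = set_monomial S].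

Definition independent_set_ideal : set {mpoly K[n + n]} :=
  ideal_gen independent_monomials.

Definition vertex_component (i : 'I_n) : set {mpoly K[n + n]} :=
  ideal_gen [set svar i; tvar i].

Definition edge_component (A : {set 'I_n}) : set {mpoly K[n + n]} :=
  ideal_gen [set p | exists2 i, i \in A & p = tvar i].

Definition components (c : 'I_n + {A : {set 'I_n} | A \in edges G}) :
    set {mpoly K[n + n]} :=
  match c with
  | inl i => vertex_component i
  | inr A => edge_component (val A)
  end.

End IndependentSets.

Arguments independent_monomials {n} G K _.
Arguments independent_set_ideal {n} G K _.
Arguments components {n} G K _ _.

(* Main.v *)
Require Import Defs.
From HB Require Import structures.
From mathcomp Require Import all_boot all_algebra.
From mathcomp Require Import boolp classical_sets.
From mathcomp Require Import mpoly.

Set Implicit Arguments.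
Unset Strict Implicit.
Unset Printing Implicit Defensive.

Import GRing.Theory.
Local Open Scope classical_set_scope.
Local Open Scope ring_scope.

(** Why the theorem holds.  Every ideal in it is generated by monomials, and
such an ideal contains a polynomial exactly when each monomial of its support
is divisible by a generator ([monomial_idealP]).  All the assertions thus
become statements about exponent vectors.

Equality.  For an exponent vector [m], let [S] be the set of vertices [i] such
that [t_i] does not divide the monomial of [m].  If that monomial lies in every
[(t_i, t_j)], then [S] is independent; if it also lies in every [(s_i, t_i)],
then [s_i] divides it for each [i] in [S], so [m_S] divides it.  Conversely
[m_S] lies in [(s_i, t_i)] because it has one of [s_i], [t_i] as a factor, and
in [(t_i, t_j)] because an independent set misses an end of each edge.

Decomposition.  The components are ideals [P_U] generated by the variables
indexed by a set [U].  Setting these variables to zero is a ring endomorphism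
with kernel [P_U] ([variable_idealE]), so [P_U] is prime and is its own
radical.  Moreover [P_U] is contained in [P_W] if and only if [U] is contained
in [W].  Hence an intersection of ideals [P_U], for [U] in an antichain, is a
minimal primary decomposition: the product of the variables outside [U] lies
in every other member of the family but not in [P_U]
([variable_ideals_decomposition]).  Here every [U] has two elements, so
distinct ones are incomparable.

Minimality of the generators.  A divisibility between [m_S] and [m_S'] forces
[S' = S], since the [s]-part is monotone in the set and the [t]-part
antitone. *)

(** * Ideals generated by a set *)

Section GeneratedIdeals.
Variable R : comNzRingType.
Implicit Types (B I : set R).

Lemma ideal_gen_is_ideal B : is_ideal (ideal_gen B).
Proof.
split=> [A [[]] //|x y Bx By A [idA BA]|a x Bx A [idA BA]];
  have [_ AD AM] := idA.
- by apply: AD; [apply: Bx | apply: By].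
- by apply: AM; apply: Bx.
Qed.

Lemma ideal_sum I (T : eqType) (r : seq T) (F : T -> R) :
  is_ideal I -> (forall i, i \in r -> I (F i)) -> I (\sum_(i <- r) F i).
Proof.
by case=> I0 ID _ IF; rewrite big_seq; apply: (big_ind I).
Qed.

End GeneratedIdeals.

(** * Monomial ideals *)

Section MonomialIdeals.
Variables (n : nat) (K : fieldType).
Implicit Types (p q : {mpoly K[n]}) (B : set {mpoly K[n]}).
Implicit Types (m d : 'X_{1..n}) (U W : {set 'I_n}).

Lemma mpolyX_inj : injective (fun m => 'X_[m] : {mpoly K[n]}).
Proof.
move=> m d /(congr1 (fun p : {mpoly K[n]} => msupp p)).
by rewrite !msuppX => -[].
Qed.

(** The polynomials all of whose monomials are multiples of generators form an
ideal, since the monomials of [p * q] are multiples of those of [q];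
conversely a polynomial is a linear combination of its own monomials. *)
Lemma monomial_idealP B p :
  (forall q, B q -> exists d, q = 'X_[d]) ->
  ideal_gen B p <->
  (forall m, m \in msupp p -> exists2 d, B 'X_[d] & (d <= m)%MM).
Proof.
move=> monB; split.
  pose I : set {mpoly K[n]} := [set f |
    forall m, m \in msupp f -> exists2 d, B 'X_[d] & (d <= m)%MM].
  apply: (@smallest_sub _ _ _ I) => [|q Bq m]; last first.
    have [d qE] := monB q Bq; rewrite qE msuppX inE => /eqP ->.
    by exists d; [rewrite -qE | exact: lepm_refl].
  split=> [m|f g If Ig m|f g Ig m] /=; first by rewrite msupp0.
    by move=> /msuppD_le; rewrite mem_cat => /orP[/If|/Ig].
  move=> /msuppM_le /allpairsP[[m1 m2] /= [_ /Ig[d Bd le_d] ->]].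
  by exists d => //; apply: lepm_trans le_d (lem_addl _ _).
move=> suppB; have [_ _ IM] := ideal_gen_is_ideal B.
rewrite [p]mpolyE; apply: ideal_sum (ideal_gen_is_ideal B) _ => m /suppB[d Bd].
move=> le_dm; rewrite -mul_mpolyC -(submK le_dm) mpolyXD mulrA.
by apply: IM; apply: sub_gen_smallest.
Qed.

Definition variable_ideal U : set {mpoly K[n]} :=
  ideal_gen [set p | exists2 i, i \in U & p = 'X_i].

Lemma variable_idealP U p :
  variable_ideal U p <->
  (forall m, m \in msupp p -> exists2 i, i \in U & m i != 0%N).
Proof.
rewrite /variable_ideal monomial_idealP; last first.
  by move=> q [i _ ->]; exists U_(i)%MM.
split=> Up m /Up[].
  by move=> d [i Ui /mpolyX_inj ->]; rewrite lep1mP; exists i.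
by move=> i Ui mi; exists U_(i)%MM; [exists i | rewrite lep1mP].
Qed.

Lemma variable_idealX U m :
  variable_ideal U 'X_[m] <-> (exists2 i, i \in U & m i != 0%N).
Proof.
rewrite variable_idealP; split; first by apply; rewrite msuppX inE.
by move=> Um d; rewrite msuppX inE => /eqP ->.
Qed.

(** * Primality of the ideals generated by variables *)

Definition kill_variables U p : {mpoly K[n]} :=
  p \mPo [tuple if i \in U then 0 else 'X_i | i < n].

HB.instance Definition _ U := GRing.LRMorphism.copy (kill_variables U)
  (comp_mpoly [tuple if i \in U then 0 else 'X_i | i < n]).

Lemma kill_variablesX U m :
  kill_variables U 'X_[m] =
  if [exists i in U, m i != 0%N] then 0 else 'X_[m].
Proof.
rewrite /kill_variables comp_mpolyX; case: exists_inP => [[i Ui mi]|Um].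
  by rewrite (bigD1 i) //= tnth_mktuple Ui expr0n (negPf mi) mul0r.
rewrite mpolyXE_id; apply: eq_bigr => i _; rewrite tnth_mktuple.
have [Ui|//] := ifP; have [->|mi] := eqVneq (m i) 0%N; first by rewrite !expr0.
by case: Um; exists i.
Qed.

(** Setting the variables of [U] to zero does not change the coefficient of a
monomial free of these variables, so a polynomial in the kernel has no such
monomial. *)
Lemma variable_idealE U :
  variable_ideal U = [set p | kill_variables U p = 0].
Proof.
apply/seteqP; split.
  apply: smallest_sub => [|q [i Ui ->] /=].
    split=> [|f g /= f0 g0|f g /= g0]; first exact: rmorph0.
      by rewrite rmorphD /= f0 g0 addr0.
    by rewrite rmorphM /= g0 mulr0.
  rewrite kill_variablesX ifT //; apply/exists_inP; exists i => //.
  by rewrite mnm1E eqxx.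
move=> p /= p0; apply/variable_idealP => m m_p.
apply/exists_inP; apply: contraLR m_p => Um; rewrite -mcoeff_eq0.
suff <- : (kill_variables U p)@_m = p@_m by rewrite p0 mcoeff0.
rewrite [in LHS](mpolyE p) [in RHS](mpolyE p).
rewrite (raddf_sum (kill_variables U)) !(raddf_sum (mcoeff m)).
apply: eq_bigr => k _; rewrite /= linearZ /= !mcoeffZ kill_variablesX.
case: ifP => // Uk; rewrite mcoeff0 mcoeffX.
by case: eqP => // km; rewrite -km Uk in Um.
Qed.

Lemma variable_ideal_prime U p q :
  variable_ideal U (p * q) -> variable_ideal U p \/ variable_ideal U q.
Proof.
rewrite variable_idealE /= rmorphM => /eqP.
by rewrite mulf_eq0 => /orP[] /eqP; [left | right].
Qed.

Lemma variable_ideal_proper U : ~ variable_ideal U 1.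
Proof.
by rewrite variable_idealE /= rmorph1; apply/eqP; exact: oner_neq0.
Qed.

Lemma radical_variable_ideal U : radical (variable_ideal U) = variable_ideal U.
Proof.
apply/seteqP; split=> [p [k]|p Up]; last by exists 1%N.
elim: k => [/variable_ideal_proper //|k IHk].
by rewrite exprS => /variable_ideal_prime[].
Qed.

Lemma variable_ideal_primary U : primary_ideal (variable_ideal U).
Proof.
split; [exact: ideal_gen_is_ideal | exact: variable_ideal_proper |].
by move=> p q; rewrite radical_variable_ideal; exact: variable_ideal_prime.
Qed.

(** * Irredundant intersections of ideals generated by variables *)

Definition outside_exponent U : 'X_{1..n} :=
  [multinom (i \notin U : nat) | i < n].

Lemma outside_exponentP U W :
  variable_ideal W 'X_[outside_exponent U] <-> ~~ (W \subset U).
Proof.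
rewrite variable_idealX; split=> [[i Wi]|/subsetPn[i Wi Ui]].
  by rewrite mnmE eqb0 negbK => Ui; apply/subsetPn; exists i.
by exists i => //; rewrite mnmE Ui.
Qed.

Lemma variable_ideal_inj : injective variable_ideal.
Proof.
suff sub U W : variable_ideal U = variable_ideal W -> U \subset W.
  by move=> U W UW; apply/eqP; rewrite finset.eqEsubset !sub.
move=> UW; apply/negPn/negP => /outside_exponentP.
by rewrite UW => /outside_exponentP; rewrite subxx.
Qed.

Lemma variable_ideals_decomposition (J : finType) (U : J -> {set 'I_n}) :
  (forall j k, U j \subset U k -> j = k) ->
  minimal_primary_decomposition
    (\bigcap_(j in [set: J]) variable_ideal (U j))
    (fun j => variable_ideal (U j)).
Proof.
move=> antichain; split=> //.
- by move=> j; exact: variable_ideal_primary.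
- move=> j k; rewrite !radical_variable_ideal => /variable_ideal_inj UU.
  by apply: antichain; rewrite UU.
- move=> j E; have : variable_ideal (U j) 'X_[outside_exponent (U j)].
    suff : (\bigcap_(k in [set: J]) variable_ideal (U k))
        'X_[outside_exponent (U j)] by exact.
    rewrite -E => k /= k_neq_j; apply/outside_exponentP.
    by apply/negP => /antichain.
  by move/outside_exponentP; rewrite subxx.
Qed.

End MonomialIdeals.

Arguments variable_ideal {n} K U _.

(** * The ideal of independent sets *)

Section IndependentSets.
Variables (n : nat) (G : sgraph n) (K : fieldType).
Implicit Types (S : {set 'I_n}) (m : 'X_{1..n + n}).

Definition set_exponent S : 'X_{1..n + n} :=
  [multinom match split k with inl i => (i \in S : nat)
                             | inr i => (i \notin S : nat) end | k < n + n].

Lemma set_exponentl S i : set_exponent S (lshift n i) = (i \in S).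
Proof. by rewrite mnmE (unsplitK (inl _)). Qed.

Lemma set_exponentr S i : set_exponent S (rshift n i) = (i \notin S).
Proof. by rewrite mnmE (unsplitK (inr _)). Qed.

Lemma set_monomialE S : set_monomial K S = 'X_[set_exponent S].
Proof.
rewrite mpolyXE_id big_split_ord /=; congr (_ * _); rewrite big_mkcond /=;
  apply: eq_bigr => i _.
  by rewrite set_exponentl; case: ifP; rewrite ?expr0.
by rewrite set_exponentr inE; case: ifP; rewrite ?expr0.
Qed.

(** The [s]-part grows with the set and the [t]-part shrinks, so distinct
[m_S] do not divide each other. *)
Lemma set_exponent_le S S' : (set_exponent S <= set_exponent S')%MM -> S = S'.
Proof.
move/mnm_lepP => le; apply/setP => i.
have := le (lshift n i); have := le (rshift n i).
by rewrite !set_exponentl !set_exponentr; do 2!case: (_ \in _).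
Qed.

Lemma independent_monomials_monomial q :
  independent_monomials G K q -> exists d : 'X_{1..n + n}, q = 'X_[d].
Proof. by case=> S _ ->; exists (set_exponent S); rewrite set_monomialE. Qed.

Lemma independent_set_idealP p :
  independent_set_ideal G K p <->
  (forall m, m \in msupp p ->
     exists2 S, independent G S & (set_exponent S <= m)%MM).
Proof.
rewrite /independent_set_ideal.
rewrite (monomial_idealP _ independent_monomials_monomial).
split=> Ip m /Ip[].
  by move=> d [S indS]; rewrite set_monomialE => /mpolyX_inj ->; exists S.
move=> S indS le; exists (set_exponent S) => //.
by exists S; rewrite ?set_monomialE.
Qed.

Lemma independent_monomials_minimal :
  minimal_monomial_generating_set
    (independent_set_ideal G K) (independent_monomials G K).
Proof.
split=> // [p|p [S indS pE] E]; first exact: independent_monomials_monomial.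
have : (ideal_gen (independent_monomials G K `\ p)) 'X_[set_exponent S].
  by rewrite E -set_monomialE; apply: sub_gen_smallest; exists S.
rewrite monomial_idealP => [|q []]; last first.
  by move=> /independent_monomials_monomial.
case/(_ (set_exponent S)); first by rewrite msuppX inE.
move=> d [[S' _ dE] dp]; move: dE dp; rewrite pE !set_monomialE.
by move=> /mpolyX_inj -> neq /set_exponent_le SS'; apply: neq; rewrite SS'.
Qed.

(** * The components *)

Definition component_variables (c : 'I_n + {A : {set 'I_n} | A \in edges G}) :
    {set 'I_(n + n)} :=
  match c with
  | inl i => [set lshift n i; rshift n i]
  | inr A => [set rshift n i | i in val A]
  end%SET.

Lemma componentsE c :
  components G K c = variable_ideal K (component_variables c).
Proof.
case: c => [i|A] /=; rewrite /vertex_component /edge_component /variable_ideal;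
  congr ideal_gen; apply/seteqP; split=> p /=.
- by case=> ->; [exists (lshift n i) | exists (rshift n i)];
    rewrite // !inE eqxx ?orbT.
- by case=> k; rewrite !inE => /orP[] /eqP -> ->; [left | right].
- by case=> i Ai ->; exists (rshift n i); rewrite // imset_f.
- by case=> k /imsetP[i Ai ->] ->; exists i.
Qed.

Lemma card_component_variables c : #|component_variables c| = 2.
Proof.
case: c => [i|A] /=; first by rewrite cards2 eq_lrshift.
by rewrite card_imset; [exact: edges_card2 (valP A) | exact: rshift_inj].
Qed.

Lemma component_variables_inj : injective component_variables.
Proof.
have not_edge i (A : {set 'I_n}) :
    [set lshift n i; rshift n i]%SET <> [set rshift n i | i in A]%SET.
  move=> /setP /(_ (lshift n i)); rewrite !inE eqxx => /esym/imsetP[k _] /eqP.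
  by rewrite eq_lrshift.
case=> [i|A] [j|B] /= E.
- have : lshift n i \in [set lshift n j; rshift n j]%SET.
    by rewrite -E !inE eqxx.
  by rewrite !inE eq_lrshift orbF => /eqP/lshift_inj ->.
- by case: (not_edge _ _ E).
- by case: (not_edge _ _ (esym E)).
- by congr inr; apply/val_inj/(imset_inj (@rshift_inj n n)).
Qed.

(** Two comparable sets of the same size are equal. *)
Lemma component_variables_antichain c c' :
  component_variables c \subset component_variables c' -> c = c'.
Proof.
move=> sub; apply: component_variables_inj; apply/eqP.
by rewrite eqEcard sub !card_component_variables.
Qed.

Lemma component_vertexP i m :
  (exists2 k, k \in component_variables (inl i) & m k != 0%N) <->
  (m (lshift n i) != 0%N) || (m (rshift n i) != 0%N).
Proof.
split=> [[k]|/orP[] mi].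
- by rewrite !inE => /orP[] /eqP -> ->; rewrite ?orbT.
- by exists (lshift n i); rewrite // !inE eqxx.
- by exists (rshift n i); rewrite // !inE eqxx orbT.
Qed.

Lemma component_edgeP A m :
  (exists2 k, k \in component_variables (inr A) & m k != 0%N) <->
  (exists2 i, i \in val A & m (rshift n i) != 0%N).
Proof.
split=> [[k /imsetP[i Ai ->] mi]|[i Ai mi]]; first by exists i.
by exists (rshift n i); rewrite // imset_f.
Qed.

(** This is where the edges enter the decomposition: by the right-hand side,
[m_S] has a variable of each edge component as a factor. *)
Lemma independentP S :
  independent G S <->
  (forall A, A \in edges G -> exists2 i, i \in A & i \notin S).
Proof.
split=> [indS A EA|meetS].
  have [i [j [_ AE]]] := cards2P _ (introT eqP (edges_card2 EA)).
  case: (boolP (A \subset S)) => [|/subsetPn //].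
  rewrite AE finset.subUset !finset.sub1set => /andP[Si Sj].
  have /forall_inP/(_ _ Sj) := forall_inP indS i Si.
  by rewrite /adjacent -AE EA.
apply/forall_inP => i Si; apply/forall_inP => j Sj; apply/negP => /meetS[k].
by rewrite !inE => /orP[] /eqP ->; rewrite ?Si ?Sj.
Qed.

Lemma divisible_by_set_monomialP m :
  (exists2 S, independent G S & (set_exponent S <= m)%MM) <->
  (forall c, exists2 k, k \in component_variables c & m k != 0%N).
Proof.
split=> [[S indS /mnm_lepP le] [i|A]|inc].
- apply/component_vertexP; have := le (lshift n i); have := le (rshift n i).
  rewrite set_exponentl set_exponentr -!lt0n.
  by case: (i \in S) => /= [_ ->|-> _]; rewrite ?orbT.
- apply/component_edgeP; have [i Ai Si] := (independentP S).1 indS _ (valP A).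
  by exists i => //; have := le (rshift n i); rewrite set_exponentr Si -lt0n.
- (* The smallest set S such that the t-part of m_S divides the monomial of m:
     a smaller set is independent more easily and has a smaller s-part. *)
  exists [set i | m (rshift n i) == 0%N]%SET.
    apply/independentP => A EA.
    have /component_edgeP[i Ai mi] := inc (inr (Sub A EA)).
    by exists i; rewrite // inE.
  apply/mnm_lepP => k; rewrite -(splitK k); case: (split k) => i /=.
    rewrite set_exponentl inE; case: eqP => //= mi.
    by have /component_vertexP := inc (inl i); rewrite mi orbF lt0n.
  by rewrite set_exponentr inE -lt0n; case: (m _).
Qed.

Lemma independent_set_ideal_components :
  independent_set_ideal G K =
  \bigcap_(c in [set: _]) variable_ideal K (component_variables c).
Proof.
apply/seteqP; split=> p.
  move=> /independent_set_idealP Ip c _; apply/variable_idealP => m /Ip.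
  by move=> /divisible_by_set_monomialP.
move=> Pp; apply/independent_set_idealP => m m_p.
apply/divisible_by_set_monomialP => c.
by have /variable_idealP := Pp c I; apply.
Qed.

End IndependentSets.

Theorem theorem2p1 (n : nat) (n_gt0 : (0 < n)%N) (G : sgraph n)
    (K : fieldType) :
  minimal_monomial_generating_set
    (independent_set_ideal G K) (independent_monomials G K) /\
  minimal_primary_decomposition
    (independent_set_ideal G K) (components G K).
Proof.
split; first exact: independent_monomials_minimal.
rewrite independent_set_ideal_components (funext (@componentsE n G K)).
exact/variable_ideals_decomposition/component_variables_antichain.
Qed.
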